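(* Every band orthoring is a spined product of a left band orthoring and a right band orthoring with respect to a weak Clifford semiring.
   Context: A semiring $(S,+,\cdot)$ is a set with two associative binary operations such that $x(y+z)=xy+xz$ and $(x+y)z=xz+yz$ (no commutativity assumed). Rings are associative with commutative addition and need not have an identity. A semiring is completely regular if it is a union of subsemirings that are rings. $E^+(S)=\{e\in S\mid e+e=e\}$. An idempotent semiring is a semiring satisfying $x+x=x$ and $x\cdot x=x$. A band semiring is an idempotent semiring satisfying $x+xy+x=x$ and $x+yx+x=x$. A left [right] band semiring is an idempotent semiring on which Green's relation $\mathcal{L}^+$ [$\mathcal{R}^+$] of the additive reduct is the least distributive lattice congruence; equivalently, an idempotent semiring satisfying $x=x+yxy$ [$x=yxy+x$]. A band [left band, right band] orthoring is a completely regular semiring $S$ such that $E^+(S)$ is a subsemiring of $S$ and is a band [left band, right band] semiring. A distributive lattice is regarded as a semiring (join as $+$, meet as $\cdot$). A weak Clifford semiring is a semiring which is a distributive lattice of rings, i.e. which has a semiring congruence whose quotient is a distributive lattice and each of whose classes is a ring. A semiring $S$ is a spined product of semirings $S_1$ and $S_2$ with respect to a semiring $T$ if there are surjective semiring homomorphisms $\phi_1:S_1\to T$ and $\phi_2:S_2\to T$ such that $S$ is isomorphic to the subsemiring $\{(a,b)\in S_1\times S_2\mid \phi_1(a)=\phi_2(b)\}$ of $S_1\times S_2$. *)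

(* Defs.v *)
From HB Require Import structures.
From mathcomp Require Import all_boot all_order generic_quotient.
From mathcomp Require Import boolp classical_sets.

Set Implicit Arguments.
Unset Strict Implicit.
Unset Printing Implicit Defensive.

Local Open Scope classical_set_scope.

Declare Scope semiring_scope.
Delimit Scope semiring_scope with SR.

(* Neither operation is assumed commutative and no neutral element is required;
   MathComp's semirings are commutative additive monoids with a unit. *)
HB.mixin Record isSemiring S := {
  sadd : S -> S -> S;
  smul : S -> S -> S;
  saddA : associative sadd;
  smulA : associative smul;
  smulDr : right_distributive smul sadd;
  smulDl : left_distributive smul sadd
}.

#[short(type="semiringType")]
HB.structure Definition Semiring := {S of isSemiring S}.

Notation "x + y" := (sadd x y) : semiring_scope.
Notation "x * y" := (smul x y) : semiring_scope.
Local Open Scope semiring_scope.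

Definition semiring_hom (S T : semiringType) (f : S -> T) : Prop :=
  (forall x y, f (x + y) = f x + f y) /\ (forall x y, f (x * y) = f x * f y).

Definition surjective (A B : Type) (f : A -> B) : Prop :=
  forall b, exists a, f a = b.

Definition isomorphic (S T : semiringType) : Prop :=
  exists f : S -> T, semiring_hom f /\ bijective f.

Record subsemiring (S : semiringType) := Subsemiring {
  subsemiring_set :> set S;
  subsemiringD : forall x y,
    subsemiring_set x -> subsemiring_set y -> subsemiring_set (x + y);
  subsemiringM : forall x y,
    subsemiring_set x -> subsemiring_set y -> subsemiring_set (x * y)
}.

Definition subsemiring_type (S : semiringType) (A : subsemiring S) : Type :=
  set_type A.

Section SubsemiringType.
Variables (S : semiringType) (A : subsemiring S).
Implicit Types x y z : subsemiring_type A.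

Definition sub_add x y : subsemiring_type A :=
  exist _ (val x + val y)
    (mem_set (subsemiringD (set_mem (valP x)) (set_mem (valP y)))).

Definition sub_mul x y : subsemiring_type A :=
  exist _ (val x * val y)
    (mem_set (subsemiringM (set_mem (valP x)) (set_mem (valP y)))).

Lemma sub_addA : associative sub_add.
Proof. by move=> x y z; apply: val_inj; rewrite /= saddA. Qed.

Lemma sub_mulA : associative sub_mul.
Proof. by move=> x y z; apply: val_inj; rewrite /= smulA. Qed.

Lemma sub_mulDr : right_distributive sub_mul sub_add.
Proof. by move=> x y z; apply: val_inj; rewrite /= smulDr. Qed.

Lemma sub_mulDl : left_distributive sub_mul sub_add.
Proof. by move=> x y z; apply: val_inj; rewrite /= smulDl. Qed.

HB.instance Definition _ := isSemiring.Build (subsemiring_type A)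
  sub_addA sub_mulA sub_mulDr sub_mulDl.
End SubsemiringType.

Section ProductSemiring.
Variables S T : semiringType.
Implicit Types x y z : S * T.

Definition prod_add x y : S * T := (x.1 + y.1, x.2 + y.2).
Definition prod_mul x y : S * T := (x.1 * y.1, x.2 * y.2).

Lemma prod_addA : associative prod_add.
Proof. by move=> x y z; rewrite /prod_add /= !saddA. Qed.

Lemma prod_mulA : associative prod_mul.
Proof. by move=> x y z; rewrite /prod_mul /= !smulA. Qed.

Lemma prod_mulDr : right_distributive prod_mul prod_add.
Proof. by move=> x y z; rewrite /prod_mul /prod_add /= !smulDr. Qed.

Lemma prod_mulDl : left_distributive prod_mul prod_add.
Proof. by move=> x y z; rewrite /prod_mul /prod_add /= !smulDl. Qed.

HB.instance Definition _ := isSemiring.Build (S * T)%type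
  prod_addA prod_mulA prod_mulDr prod_mulDl.
End ProductSemiring.

Record congruence (S : semiringType) := Congruence {
  cong_rel :> S -> S -> Prop;
  cong_refl : forall x, cong_rel x x;
  cong_sym : forall x y, cong_rel x y -> cong_rel y x;
  cong_trans : forall x y z, cong_rel x y -> cong_rel y z -> cong_rel x z;
  congD : forall x x' y y',
    cong_rel x x' -> cong_rel y y' -> cong_rel (x + y) (x' + y');
  congM : forall x x' y y',
    cong_rel x x' -> cong_rel y y' -> cong_rel (x * y) (x' * y')
}.

Section QuotientSemiring.
Variables (S : semiringType) (rho : congruence S).
Local Open Scope quotient_scope.

Definition cong_bool : rel {classic S} := fun x y => `[< rho x y >].

Lemma cong_bool_refl : reflexive cong_bool.
Proof. by move=> x; apply/asboolP; apply: cong_refl. Qed.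

Lemma cong_bool_sym : symmetric cong_bool.
Proof. by move=> x y; apply/asboolP/asboolP; apply: cong_sym. Qed.

Lemma cong_bool_trans : transitive cong_bool.
Proof.
by move=> y x z /asboolP xy /asboolP yz; apply/asboolP; apply: cong_trans yz.
Qed.

Canonical cong_equiv :=
  EquivRel cong_bool cong_bool_refl cong_bool_sym cong_bool_trans.

Definition quot : Type := {eq_quot cong_equiv}.

Definition quot_pi (x : S) : quot := \pi_{eq_quot cong_equiv} (x : {classic S}).
Definition quot_repr (u : quot) : S := repr (u : {eq_quot cong_equiv}).

Lemma quot_reprK (u : quot) : quot_pi (quot_repr u) = u.
Proof. exact: reprK. Qed.

Lemma quot_piP (x y : S) : quot_pi x = quot_pi y <-> rho x y.
Proof. by split=> [/eqquotP/asboolP | xy] //; apply/eqquotP/asboolP. Qed.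

Definition quot_add (u v : quot) : quot := quot_pi (quot_repr u + quot_repr v).
Definition quot_mul (u v : quot) : quot := quot_pi (quot_repr u * quot_repr v).

Lemma quot_piD x y : quot_pi (x + y) = quot_add (quot_pi x) (quot_pi y).
Proof.
by apply/quot_piP/congD; apply/quot_piP; rewrite quot_reprK.
Qed.

Lemma quot_piM x y : quot_pi (x * y) = quot_mul (quot_pi x) (quot_pi y).
Proof.
by apply/quot_piP/congM; apply/quot_piP; rewrite quot_reprK.
Qed.

Lemma quot_addA : associative quot_add.
Proof.
move=> u v w; rewrite -(quot_reprK u) -(quot_reprK v) -(quot_reprK w).
by rewrite -!quot_piD saddA.
Qed.

Lemma quot_mulA : associative quot_mul.
Proof.
move=> u v w; rewrite -(quot_reprK u) -(quot_reprK v) -(quot_reprK w).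
by rewrite -!quot_piM smulA.
Qed.

Lemma quot_mulDr : right_distributive quot_mul quot_add.
Proof.
move=> u v w; rewrite -(quot_reprK u) -(quot_reprK v) -(quot_reprK w).
by rewrite -?(quot_piD, quot_piM) smulDr.
Qed.

Lemma quot_mulDl : left_distributive quot_mul quot_add.
Proof.
move=> u v w; rewrite -(quot_reprK u) -(quot_reprK v) -(quot_reprK w).
by rewrite -?(quot_piD, quot_piM) smulDl.
Qed.

HB.instance Definition _ := isSemiring.Build quot
  quot_addA quot_mulA quot_mulDr quot_mulDl.
End QuotientSemiring.

Definition lattice_type (d : Order.disp_t) (L : distrLatticeType d) : Type := L.

Section LatticeSemiring.
Variables (d : Order.disp_t) (L : distrLatticeType d).

HB.instance Definition _ := isSemiring.Build (lattice_type L)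
  (@Order.JoinTheory.joinA d L) (@Order.MeetTheory.meetA d L)
  (@Order.DistrLatticeTheory.meetUr d L) (@Order.DistrLatticeTheory.meetUl d L).
End LatticeSemiring.

Definition is_distributive_lattice (S : semiringType) : Prop :=
  exists (d : Order.disp_t) (L : distrLatticeType d),
    isomorphic S (lattice_type L).

Definition distributive_lattice_congruence (S : semiringType)
  (rho : congruence S) : Prop := is_distributive_lattice (quot rho).

(* Associativity and distributivity come from the semiring; no unit is assumed. *)
Definition is_ring (S : semiringType) : Prop :=
  commutative (@sadd S) /\
  exists z : S, left_id z (@sadd S) /\
    exists opp : S -> S, left_inverse z opp (@sadd S).

Definition completely_regular (S : semiringType) : Prop :=
  forall x : S, exists A : subsemiring S, subsemiring_set A x /\ is_ring (subsemiring_type A).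

Definition Eplus (S : semiringType) : set S := [set e | e + e = e].

Definition idempotent_semiring (S : semiringType) : Prop :=
  (forall x : S, x + x = x) /\ (forall x : S, x * x = x).

Definition band_semiring (S : semiringType) : Prop :=
  idempotent_semiring S /\
  (forall x y : S, x + x * y + x = x) /\ (forall x y : S, x + y * x + x = x).

(* Additive principal ideals S^1 + a and a + S^1. *)
Definition left_ideal (S : semiringType) (a : S) : set S :=
  [set x | x = a \/ exists u, x = u + a].

Definition right_ideal (S : semiringType) (a : S) : set S :=
  [set x | x = a \/ exists u, x = a + u].

Definition greenL (S : semiringType) (a b : S) : Prop :=
  left_ideal a = left_ideal b.

Definition greenR (S : semiringType) (a b : S) : Prop :=
  right_ideal a = right_ideal b.

Definition is_least_distributive_lattice_congruence (S : semiringType)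
    (r : S -> S -> Prop) : Prop :=
  exists rho : congruence S,
    [/\ forall a b, rho a b <-> r a b,
        distributive_lattice_congruence rho
      & forall sigma : congruence S, distributive_lattice_congruence sigma ->
          forall a b, rho a b -> sigma a b].

Definition left_band_semiring (S : semiringType) : Prop :=
  idempotent_semiring S /\ is_least_distributive_lattice_congruence (@greenL S).

Definition right_band_semiring (S : semiringType) : Prop :=
  idempotent_semiring S /\ is_least_distributive_lattice_congruence (@greenR S).

Definition orthoring_over (P : semiringType -> Prop) (S : semiringType) : Prop :=
  completely_regular S /\
  exists E : subsemiring S,
    (E : set S) = @Eplus S /\ P (subsemiring_type E).

Definition band_orthoring : semiringType -> Prop :=
  orthoring_over band_semiring.

Definition left_band_orthoring : semiringType -> Prop :=
  orthoring_over left_band_semiring.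

Definition right_band_orthoring : semiringType -> Prop :=
  orthoring_over right_band_semiring.

Definition weak_clifford (S : semiringType) : Prop :=
  exists rho : congruence S,
    distributive_lattice_congruence rho /\
    forall x : S, exists A : subsemiring S,
      (A : set S) = [set y | rho x y] /\ is_ring (subsemiring_type A).

Section Pullback.
Variables (S1 S2 T : semiringType) (phi1 : S1 -> T) (phi2 : S2 -> T).
Hypotheses (hom1 : semiring_hom phi1) (hom2 : semiring_hom phi2).

Definition pullback_set : set (S1 * S2) :=
  [set x | phi1 x.1 = phi2 x.2].

Lemma pullbackD (x y : S1 * S2) :
  pullback_set x -> pullback_set y -> pullback_set (x + y).
Proof.
by rewrite /pullback_set /= => ex ey; rewrite hom1.1 hom2.1 ex ey.
Qed.

Lemma pullbackM (x y : S1 * S2) :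
  pullback_set x -> pullback_set y -> pullback_set (x * y).
Proof.
by rewrite /pullback_set /= => ex ey; rewrite hom1.2 hom2.2 ex ey.
Qed.

Definition pullback : subsemiring (S1 * S2)%type :=
  @Subsemiring (S1 * S2)%type pullback_set pullbackD pullbackM.
End Pullback.

Definition spined_product (S S1 S2 T : semiringType) : Prop :=
  exists (phi1 : S1 -> T) (phi2 : S2 -> T)
         (hom1 : semiring_hom phi1) (hom2 : semiring_hom phi2),
    [/\ surjective phi1, surjective phi2
      & isomorphic S (subsemiring_type (pullback hom1 hom2))].

(* Main.v *)
Require Import Defs.
From mathcomp Require Import all_boot.
From HB Require Import structures.
From mathcomp Require Import all_order boolp classical_sets.

(** Every element x of a completely regular semiring S has a zero x^0, the zero
of the rings that contain it.  Multiplying by zeros shows that in a band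
orthoring x |-> x^0 is a semiring homomorphism onto E = E^+(S) ([zeroD],
[zeroM]), so that structure on the idempotents can be pulled back to S.

The heart of the matter is that the additive band of a band semiring is
regular: a + b + a + c + a = a + b + c + a ([band_add_regular]).  Say that e
absorbs z when e + z + e = e.  If s and t both absorb a, then with P = s + t
and Q = s + a + t the two ways of expanding the product Q P by distributivity
give P and Q Q, whence P = Q ([add_common_absorbed]); regularity is the case
of a + b and c + a, which absorb a.  In a regular band Green's relations L and
R are congruences for addition; mutual absorption D is always one, and here
its quotient is a distributive lattice ([band_D_lattice]).

Three congruences on S come out of this.  [cong_D] and [cong_L] are the
pullbacks along x |-> x^0 of D and L on E.  The third, [cong_R], is the
relation x = y + x^0 and y = x + y^0: it implies R on the zeros but also keeps
track of the ring components of x and y.  Then [cong_R] and [cong_L] intersect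
in equality, and their composite is [cong_D], because x [cong_D] y gives
x [cong_R] (x + y^0) [cong_L] y.  Hence S is the spined product of S/[cong_R]
and S/[cong_L] over S/[cong_D] ([spined_product_quot]).  Idempotents of a
quotient of S lift to E ([quot_idem_lift]), and there x + y + x is identified
with x + y by [cong_R] and with y + x by [cong_L], so that the two factors are
a left and a right band orthoring.

All the ring structure is placed in the left factor, and the common quotient
is a distributive lattice, that is, a distributive lattice of zero rings.
The reason is that complete regularity makes addition commutative inside
each covering ring only: two elements with the same zero that lie in no common
ring need not commute (take a nonabelian group as additive reduct, with all
products 0).  A common quotient that kept the ring components could therefore
fail to be a weak Clifford semiring. *)

Set Implicit Arguments.
Unset Strict Implicit.
Unset Printing Implicit Defensive.

Local Open Scope semiring_scope.

(** * Distributive lattices as semirings *)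

Definition lattice_laws (Q : semiringType) : Prop :=
  [/\ commutative (@sadd Q), forall x : Q, x * x = x,
      forall x y : Q, x + x * y = x & forall x y : Q, x + y * x = x].

Section LatticeLaws.
Variables (Q : semiringType) (hQ : lattice_laws Q).
Implicit Types x y z : Q.

Lemma lattice_addC x y : x + y = y + x. Proof. by case: hQ. Qed.
Lemma lattice_mulxx x : x * x = x. Proof. by case: hQ. Qed.
Lemma lattice_joinKr x y : x + x * y = x. Proof. by case: hQ. Qed.
Lemma lattice_joinKl x y : x + y * x = x. Proof. by case: hQ. Qed.

(** Absorption makes u * v = u * (v * u) * v a part of v * u; exchanging u and v
and using that addition commutes gives equality. *)
Lemma lattice_mulC x y : x * y = y * x.
Proof.
have le (u v : Q) : v * u + u * v = v * u.
  have -> : u * v = u * (v * u) * v by rewrite smulA -smulA lattice_mulxx.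
  rewrite -{1}[v * u](lattice_joinKl _ u) -saddA lattice_joinKr.
  exact: lattice_joinKl.
by rewrite -(le x y) lattice_addC le.
Qed.

Lemma lattice_lawsP : is_distributive_lattice Q.
Proof.
pose T : choiceType := {classic Q}.
pose mt (x y : T) : T := (x : Q) * (y : Q).
pose jn (x y : T) : T := (x : Q) + (y : Q).
pose le (x y : T) := mt x y == x.
pose lt (x y : T) := (y != x) && le x y.
have jKI y x : mt x (jn x y) = x.
  by rewrite /mt /jn smulDr lattice_mulxx lattice_joinKr.
pose d := Order.Disp tt tt.
pose L : distrLatticeType d := HB.pack (Choice.sort T)
  (@Order.isMeetJoinDistrLattice.Build d T le lt mt jn
    (fun _ _ => erefl) (fun _ _ => erefl) lattice_mulC lattice_addC
    (@smulA Q) (@saddA Q) jKI (fun y x => lattice_joinKr x y)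
    (@smulDl Q) lattice_mulxx).
exists d, L, (id : Q -> lattice_type L); split; first by split.
by exists id.
Qed.

End LatticeLaws.

Definition trivial_congruence (Q : semiringType) : congruence Q :=
  @Congruence Q eq (fun=> erefl) (fun _ _ => @esym _ _ _)
    (fun _ _ _ => @etrans _ _ _ _)
    (fun _ _ _ _ e f => congr2 (@sadd Q) e f)
    (fun _ _ _ _ e f => congr2 (@smul Q) e f).

Section Quotients.
Variables (S : semiringType) (rho : congruence S).

Lemma quot_pi_hom : @semiring_hom S (quot rho) (quot_pi rho).
Proof. by split=> x y; [exact: quot_piD | exact: quot_piM]. Qed.

Lemma quot_ind (P : quot rho -> Prop) :
  (forall x, P (quot_pi rho x)) -> forall u, P u.
Proof. by move=> Px u; rewrite -(quot_reprK u). Qed.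

Lemma quot_lattice_laws :
    (forall x y, rho (x + y) (y + x)) -> (forall x, rho (x * x) x) ->
    (forall x y, rho (x + x * y) x) -> (forall x y, rho (x + y * x) x) ->
  lattice_laws (quot rho).
Proof.
have [piD piM] := quot_pi_hom => hC hM hr hl.
split; do ![elim/quot_ind=> ?]; rewrite -?piM -?piD; exact/quot_piP.
Qed.

End Quotients.

(** A distributive lattice is a distributive lattice of zero rings: its
elements, taken as the classes of equality. *)
Lemma lattice_weak_clifford (Q : semiringType) :
  lattice_laws Q -> weak_clifford Q.
Proof.
move=> hQ; exists (trivial_congruence Q); split.
  apply: lattice_lawsP; case: hQ => *; exact: quot_lattice_laws.
have addxx (x : Q) : x + x = x.
  by rewrite -{2}(lattice_mulxx hQ x) lattice_joinKr.
move=> x.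
have clD y z : x = y -> x = z -> x = y + z by move=> <- <-.
have clM y z : x = y -> x = z -> x = y * z.
  by move=> <- <-; rewrite lattice_mulxx.
pose A := @Subsemiring Q [set y | x = y]%classic clD clM.
have Aeq (u v : subsemiring_type A) : u = v.
  by apply: val_inj; rewrite -(set_mem (valP u)) -(set_mem (valP v)).
exists A; split=> //; split; first by move=> *; apply: Aeq.
pose z : subsemiring_type A := exist _ x (mem_set (erefl x)).
by exists z; split; [|exists id]; move=> *; apply: Aeq.
Qed.

(** * Spined products of quotients *)

Section Spined.
Variables (S : semiringType) (rho1 rho2 tau : congruence S).

Definition quot_map (rho : congruence S) (u : quot rho) : quot tau :=
  quot_pi tau (quot_repr u).

Section QuotMap.
Variable rho : congruence S.
Hypothesis rho_tau : forall x y, rho x y -> tau x y.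

Lemma quot_mapE x : quot_map (quot_pi rho x) = quot_pi tau x.
Proof. by apply/quot_piP/rho_tau/quot_piP; rewrite quot_reprK. Qed.

Lemma quot_map_hom : semiring_hom (@quot_map rho).
Proof.
have [[rD rM] [tD tM]] := (quot_pi_hom rho, quot_pi_hom tau).
split; do 2![elim/quot_ind=> ?].
- by rewrite -rD !quot_mapE tD.
- by rewrite -rM !quot_mapE tM.
Qed.

Lemma quot_map_surj : surjective (@quot_map rho).
Proof. by elim/quot_ind=> x; exists (quot_pi rho x); rewrite quot_mapE. Qed.

End QuotMap.

(** Injectivity of S -> S/rho1 x S/rho2 is the trivial intersection; the
inclusion of tau in the composite says that every compatible pair of classes
has a common representative. *)
Lemma spined_product_quot :
    (forall x y, rho1 x y -> tau x y) -> (forall x y, rho2 x y -> tau x y) ->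
    (forall x y, rho1 x y -> rho2 x y -> x = y) ->
    (forall x y, tau x y -> exists z, rho1 x z /\ rho2 z y) ->
  spined_product S (quot rho1) (quot rho2) (quot tau).
Proof.
move=> le1 le2 cap12 comp12.
exists (@quot_map rho1), (@quot_map rho2), (quot_map_hom le1),
  (quot_map_hom le2).
split; [exact: quot_map_surj | exact: quot_map_surj |].
set A := pullback _ _.
have inA x : subsemiring_set A (quot_pi rho1 x, quot_pi rho2 x).
  by rewrite /= /pullback_set /= !quot_mapE.
pose f x : subsemiring_type A :=
    exist _ (quot_pi rho1 x, quot_pi rho2 x) (mem_set (inA x)).
have f_surj w : exists x, f x = w.
  case: w => -[u v] uv; move: (set_mem uv); rewrite /= /pullback_set /=.
  elim/quot_ind: u uv => x; elim/quot_ind: v => y uv.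
  rewrite !quot_mapE // => /quot_piP /comp12[z [xz zy]].
  exists z; apply: val_inj => /=; congr pair; apply/quot_piP => //.
  exact: cong_sym.
have [g gK] := choice f_surj.
exists f; split.
  by split=> x y; apply: val_inj; congr pair; [exact: quot_piD | exact: quot_piD
    | exact: quot_piM | exact: quot_piM].
exists g => // x; have /(congr1 val)[] := gK (f x).
by move=> /quot_piP e1 /quot_piP e2; apply: cap12.
Qed.

End Spined.

(** * Constructing congruences *)

Definition congruence_of_translations (S : semiringType) (r : S -> S -> Prop)
    (r_refl : forall x, r x x) (r_sym : forall x y, r x y -> r y x)
    (r_trans : forall x y z, r x y -> r y z -> r x z)
    (addl : forall z x y, r x y -> r (z + x) (z + y))
    (addr : forall z x y, r x y -> r (x + z) (y + z))
    (mull : forall z x y, r x y -> r (z * x) (z * y))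
    (mulr : forall z x y, r x y -> r (x * z) (y * z)) : congruence S :=
  @Congruence S r r_refl r_sym r_trans
    (fun _ _ _ _ xx' yy' => r_trans _ _ _ (addr _ _ _ xx') (addl _ _ _ yy'))
    (fun _ _ _ _ xx' yy' => r_trans _ _ _ (mulr _ _ _ xx') (mull _ _ _ yy')).

Definition congruence_preim (S T : semiringType) (f : S -> T)
    (hf : semiring_hom f) (rho : congruence T) : congruence S.
Proof.
exists (fun x y => rho (f x) (f y)) => [x|x y|x y z|x x' y y'|x x' y y'].
- exact: cong_refl.
- exact: cong_sym.
- exact: cong_trans.
- by rewrite !hf.1; apply: congD.
- by rewrite !hf.2; apply: congM.
Defined.

Lemma preim_lattice_laws (S T : semiringType) (f : S -> T)
    (hf : semiring_hom f) (rho : congruence T) :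
  lattice_laws (quot rho) -> lattice_laws (quot (congruence_preim hf rho)).
Proof.
have [piD piM] := quot_pi_hom rho; have [fD fM] := hf.
move=> [addC mulxx absr absl].
have lift x y : quot_pi rho (f x) = quot_pi rho (f y) ->
    congruence_preim hf rho x y by move/quot_piP.
by apply: quot_lattice_laws => [x y|x|x y|x y]; apply: lift;
  rewrite ?(fD, fM, piD, piM).
Qed.

Lemma lattice_congruence_addC (B : semiringType) (sigma : congruence B)
    (a b : B) :
  distributive_lattice_congruence sigma -> sigma (a + b) (b + a).
Proof.
case=> d [L [f [[fD _] /bij_inj finj]]]; apply/quot_piP/finj.
rewrite !(quot_pi_hom sigma).1 !fD.
exact: Order.JoinTheory.joinC.
Qed.

(** * The additive band of a band semiring *)

Section BandSemiring.
Variables (B : semiringType) (hB : band_semiring B).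
Implicit Types a b c e f s t u w x y z : B.

Lemma band_addxx x : x + x = x. Proof. exact: hB.1.1. Qed.
Lemma band_mulxx x : x * x = x. Proof. exact: hB.1.2. Qed.

(** In the semilattice of D-classes of the additive band, this says that the
class of z lies below the class of e, sums being joins.  In a band semiring
products are meets, by the two defining identities. *)
Definition absorbs e z : Prop := e + z + e = e.

Lemma absorbs_refl e : absorbs e e.
Proof. by rewrite /absorbs !band_addxx. Qed.

Lemma absorbs_mull e x : absorbs e (x * e). Proof. exact: hB.2.2. Qed.
Lemma absorbs_mulr e x : absorbs e (e * x). Proof. exact: hB.2.1. Qed.

Lemma absorbsD e z w : absorbs e z -> absorbs e w -> absorbs e (z + w).
Proof.
rewrite /absorbs => ez ew.
(* w + e + z occurs inside e = (e + w + e) + (e + z + e) and is idempotent;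
   doubling it creates the summand z + w. *)
transitivity (e + w + e + (z + w) + (e + z + e)).
  by rewrite ew ez !saddA.
transitivity (e + ((w + e + z) + (w + e + z)) + e).
  by rewrite !saddA.
by rewrite band_addxx !saddA ew ez.
Qed.

(** If e = u + p with p idempotent then e + p = e, and symmetrically on the
left; applied to the two ends of e + x + z + y + e, this strips x and y. *)
Lemma absorbs_infix e x z y : absorbs e (x + z + y) -> absorbs e z.
Proof.
rewrite /absorbs => exzye.
have exP : (e + x) + (z + y + e) = e by rewrite -[RHS]exzye !saddA.
have eP : (e + z) + (y + e) = e.
  transitivity (e + (z + y + e)); first by rewrite !saddA.
  by rewrite -{1}exP -saddA band_addxx exP.
by rewrite -[X in e + z + X]eP saddA band_addxx eP.
Qed.

Lemma absorbs_trans w e z : absorbs e w -> absorbs w z -> absorbs e z.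
Proof.
move=> ew wz; apply: (@absorbs_infix e w z w); by rewrite wz.
Qed.

Lemma absorbs_mul2l c e z : absorbs e z -> absorbs (c * e) (c * z).
Proof. by rewrite /absorbs -!smulDr => ->. Qed.

Lemma absorbs_mul2r c e z : absorbs e z -> absorbs (e * c) (z * c).
Proof. by rewrite /absorbs -!smulDl => ->. Qed.

Lemma absorbs_mulC x y : absorbs (y * x) (x * y).
Proof.
have -> : x * y = x * (y * x) * y.
  by rewrite smulA -smulA band_mulxx.
apply: absorbs_trans (absorbs_mulr _ _).
exact: absorbs_mull.
Qed.

(** D-classes are rectangular bands, where only the outer summands matter. *)
Lemma add_absorbed e f z :
  absorbs e f -> absorbs f e -> absorbs e z -> e + z + f = e + f.
Proof.
move=> ef fe ez; rewrite -{1}fe !saddA.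
by rewrite -(saddA e z) (absorbsD ez ef).
Qed.

(** For P = s + t and Q = s + a + t, compare Q * Q and the two expansions of
Q * P.  The products s * t and t * s are D-equivalent and absorb every
product in which a is a factor, so such terms may be dropped whenever they
stand between s * t and t * s.  Dropping them turns Q * Q into one expansion
of Q * P, and the other expansion into P * P. *)
Lemma add_common_absorbed s t a :
  absorbs s a -> absorbs t a -> s + a + t = s + t.
Proof.
move=> sa ta.
have st_ts : absorbs (s * t) (t * s) by exact: absorbs_mulC.
have ts_st : absorbs (t * s) (s * t) by exact: absorbs_mulC.
have st_a : absorbs (s * t) a.
  apply: (absorbs_trans (w := a * t)); first exact: absorbs_mul2r.
  by rewrite -[X in absorbs _ X]band_mulxx; apply: absorbs_mul2l.
have ts_a := absorbs_trans ts_st st_a.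
pose P := s + t; pose Q := s + a + t.
(* Expanding the right factor first groups the terms by their right factor. *)
have QQ : Q * Q = s + a * s + (t * s + s * t) + a * t + t.
  transitivity (s + a * s + (t * s + (s * a + a + t * a) + s * t) + a * t + t).
    by rewrite /Q !smulDr !smulDl !band_mulxx !saddA.
  rewrite (@add_absorbed (t * s) (s * t)) //.
  apply: absorbsD; first apply: absorbsD => //.
    by apply: absorbs_trans ts_a _; apply: absorbs_mull.
  by apply: absorbs_trans ts_a _; apply: absorbs_mull.
have QP1 : Q * P = s + a * s + (t * s + s * t) + a * t + t.
  by rewrite /Q /P !smulDr !smulDl !band_mulxx !saddA.
(* Expanding the left factor first groups them by their left factor. *)
have QP2 : Q * P = P.
  transitivity (s + (s * t + (a * s + a * t) + t * s) + t).
    by rewrite /Q /P !smulDl !smulDr !band_mulxx !saddA.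
  rewrite (@add_absorbed (s * t) (t * s)) //; last first.
    apply: absorbsD; apply: (absorbs_trans st_a); exact: absorbs_mulr.
  transitivity (P * P); last exact: band_mulxx.
  by rewrite /P !smulDl !smulDr !band_mulxx !saddA.
by rewrite -/P -/Q -(band_mulxx Q) QQ -QP1.
Qed.

Lemma band_add_regular a b c : a + b + a + c + a = a + b + c + a.
Proof.
have := @add_common_absorbed (a + b) (c + a) a; rewrite !saddA; apply.
  rewrite /absorbs; transitivity ((a + b) + (a + a + b)).
    by rewrite !saddA.
  by rewrite !band_addxx.
rewrite /absorbs; transitivity (c + (a + a) + (c + a)); first by rewrite !saddA.
by rewrite !band_addxx.
Qed.

Lemma absorbs_addl x y : absorbs (x + y) x.
Proof.
apply: (@absorbs_infix _ x _ y); rewrite band_addxx; exact: absorbs_refl.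
Qed.

Lemma absorbs_addr x y : absorbs (x + y) y.
Proof.
apply: (@absorbs_infix _ x _ y); rewrite -saddA band_addxx.
exact: absorbs_refl.
Qed.

Lemma absorbs_add2l z x y : absorbs x y -> absorbs (z + x) (z + y).
Proof.
move=> xy; apply: absorbsD (absorbs_addl z x) _.
exact: absorbs_trans (absorbs_addr z x) xy.
Qed.

Lemma absorbs_add2r z x y : absorbs x y -> absorbs (x + z) (y + z).
Proof.
move=> xy; apply: absorbsD (absorbs_addr x z).
exact: absorbs_trans (absorbs_addl x z) xy.
Qed.

Definition band_D : congruence B.
Proof.
apply: (@congruence_of_translations B (fun x y => absorbs x y /\ absorbs y x)).
- by move=> x; split; apply: absorbs_refl.
- by move=> x y [].
- move=> x y z [xy yx] [yz zy].
  by split; [apply: absorbs_trans yz | apply: absorbs_trans yx].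
- by move=> z x y [xy yx]; split; apply: absorbs_add2l.
- by move=> z x y [xy yx]; split; apply: absorbs_add2r.
- by move=> z x y [xy yx]; split; apply: absorbs_mul2l.
- by move=> z x y [xy yx]; split; apply: absorbs_mul2r.
Defined.

Lemma band_DE x y : band_D x y = (absorbs x y /\ absorbs y x).
Proof. exact: erefl. Qed.

Lemma band_D_lattice : lattice_laws (quot band_D).
Proof.
apply: quot_lattice_laws => [x y|x|x y|x y]; rewrite band_DE.
- have DC u v : absorbs (u + v) (v + u).
    exact: absorbsD (absorbs_addr u v) (absorbs_addl u v).
  by split; apply: DC.
- by rewrite band_mulxx; split; apply: absorbs_refl.
- split; first exact: absorbs_addl.
  exact: absorbsD (absorbs_refl x) (absorbs_mulr x y).
- split; first exact: absorbs_addl.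
  exact: absorbsD (absorbs_refl x) (absorbs_mull x y).
Qed.

(** Regularity is what makes Green's relation L compatible with addition on
the left; on the right it is so in every band. *)
Lemma left_zero_add2l z x y : x + y = x -> y + x = y -> z + x + (z + y) = z + x.
Proof.
move=> xy yx; transitivity (z + (x + z + y + x)).
  by rewrite -{1}yx !saddA.
rewrite -band_add_regular -(saddA _ x y) xy -(saddA _ x x) band_addxx.
by rewrite !saddA -saddA band_addxx.
Qed.

Lemma left_zero_add2r z x y : x + y = x -> x + z + (y + z) = x + z.
Proof.
by move=> xy; rewrite -{1}xy -[x + y + z]saddA -saddA band_addxx saddA xy.
Qed.

Definition band_L : congruence B.
Proof.
apply: (@congruence_of_translations B (fun x y => x + y = x /\ y + x = y)).
- by move=> x; rewrite band_addxx.
- by move=> x y [].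
- move=> x y z [xy yx] [yz zy]; split.
    by rewrite -xy -saddA yz.
  by rewrite -zy -saddA yx.
- by move=> z x y [xy yx]; split; apply: left_zero_add2l.
- by move=> z x y [xy yx]; split; apply: left_zero_add2r.
- by move=> z x y [xy yx]; rewrite -!smulDr xy yx.
- by move=> z x y [xy yx]; rewrite -!smulDl xy yx.
Defined.

(** Compatibility of Green's relation R with addition on the right, the dual
use of regularity. *)
Lemma band_addR c x y : x + y = y -> y + x = x -> y + c + x + c = x + c.
Proof.
move=> xy yx.
transitivity (x + y + c + x + c); first by rewrite xy.
by rewrite -band_add_regular -(saddA x y x) yx band_addxx -saddA band_addxx.
Qed.

(** When x + y + x = x + y, mutual absorption is the same as L.  Any
distributive lattice congruence identifies a + b and b + a, which are a and b
for L-related a and b, so D = L is the least one. *)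
Lemma left_regular_left_band :
  (forall x y, x + y + x = x + y) -> left_band_semiring B.
Proof.
move=> left_reg; split; first exact: hB.1.
exists band_D; split.
- move=> a b; rewrite band_DE /absorbs !left_reg /greenL; split=> [[ab ba]|ab].
    apply/seteqP; split=> x /= [->|[u ->]]; right.
    + by exists a; rewrite ab.
    + by exists (u + a); rewrite -saddA ab.
    + by exists b; rewrite ba.
    + by exists (u + b); rewrite -saddA ba.
  have inL u : left_ideal u u by left.
  split.
    have : left_ideal b a by rewrite -ab; apply: inL.
    by case=> [->|[u ->]]; rewrite -?saddA band_addxx.
  have : left_ideal a b by rewrite ab; apply: inL.
  by case=> [->|[u ->]]; rewrite -?saddA band_addxx.
- exact/lattice_lawsP/band_D_lattice.
- move=> sigma sigmaL a b; rewrite band_DE /absorbs !left_reg => -[] ab ba.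
  rewrite -[X in sigma X _]ab -[X in sigma _ X]ba.
  exact: lattice_congruence_addC.
Qed.

Lemma right_regular_right_band :
  (forall x y, x + y + x = y + x) -> right_band_semiring B.
Proof.
move=> right_reg; split; first exact: hB.1.
exists band_D; split.
- move=> a b; rewrite band_DE /absorbs !right_reg /greenR; split=> [[ba ab]|ab].
    apply/seteqP; split=> x /= [->|[u ->]]; right.
    + by exists a; rewrite ba.
    + by exists (a + u); rewrite saddA ba.
    + by exists b; rewrite ab.
    + by exists (b + u); rewrite saddA ab.
  have inR u : right_ideal u u by left.
  split.
    have : right_ideal b a by rewrite -ab; apply: inR.
    by case=> [->|[u ->]]; rewrite ?saddA band_addxx.
  have : right_ideal a b by rewrite ab; apply: inR.
  by case=> [->|[u ->]]; rewrite ?saddA band_addxx.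
- exact/lattice_lawsP/band_D_lattice.
- move=> sigma sigmaL a b; rewrite band_DE /absorbs !right_reg => -[] ba ab.
  rewrite -[X in sigma X _]ba -[X in sigma _ X]ab.
  exact: lattice_congruence_addC.
Qed.

End BandSemiring.

(** * Images of rings, bands and completely regular semirings *)

Lemma image_is_ring (R R' : semiringType) (f : R -> R') :
  semiring_hom f -> surjective f -> is_ring R -> is_ring R'.
Proof.
move=> [fD _] fsurj [addC [z [add0 [opp oppK]]]].
have [g gK] := choice fsurj.
split=> [u v|]; first by rewrite -(gK u) -(gK v) -!fD addC.
exists (f z); split=> [u|]; first by rewrite -(gK u) -fD add0.
by exists (fun u => f (opp (g u))) => u; rewrite -{2}(gK u) -fD oppK.
Qed.

Lemma image_band_semiring (B B' : semiringType) (f : B -> B') :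
  semiring_hom f -> surjective f -> band_semiring B -> band_semiring B'.
Proof.
move=> [fD fM] fsurj [[addxx mulxx] [absr absl]].
have [g gK] := choice fsurj.
split; split.
- by move=> x; rewrite -(gK x) -fD addxx.
- by move=> x; rewrite -(gK x) -fM mulxx.
- by move=> x y; rewrite -(gK x) -(gK y) -fM -!fD absr.
- by move=> x y; rewrite -(gK x) -(gK y) -fM -!fD absl.
Qed.

Section ImageSubsemiring.
Variables (S T : semiringType) (f : S -> T) (hf : semiring_hom f).
Variable A : subsemiring S.

Definition image_subsemiring : subsemiring T.
Proof.
exists (f @` A)%classic => _ _ [x Ax <-] [y Ay <-].
  by exists (x + y); [apply: subsemiringD | rewrite hf.1].
by exists (x * y); [apply: subsemiringM | rewrite hf.2].
Defined.

Lemma image_subsemiring_onto :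
  exists g : subsemiring_type A -> subsemiring_type image_subsemiring,
    semiring_hom g /\ surjective g.
Proof.
pose g (u : subsemiring_type A) : subsemiring_type image_subsemiring :=
  exist _ (f (val u))
    (mem_set (ex_intro2 _ _ (val u) (set_mem (valP u)) erefl)).
exists g; split.
  by split=> u v; apply: val_inj; rewrite /= ?hf.1 ?hf.2.
move=> [y my]; have [x Ax xy] := set_mem my.
by exists (exist _ x (mem_set Ax)); apply: val_inj.
Qed.

End ImageSubsemiring.

Lemma quot_completely_regular (S : semiringType) (rho : congruence S) :
  completely_regular S -> completely_regular (quot rho).
Proof.
move=> crS; elim/quot_ind=> x; have [A [Ax ringA]] := crS x.
exists (image_subsemiring (quot_pi_hom rho) A); split; first by exists x.
have [g [ghom gsurj]] := image_subsemiring_onto (quot_pi_hom rho) A.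
exact: image_is_ring ghom gsurj ringA.
Qed.

(** * Zeros of a completely regular semiring *)

Record local_zeros (S : semiringType) := LocalZeros {
  zero_at : S -> S;
  opp_at : S -> S;
  addx0 : forall x, x + zero_at x = x;
  addxN : forall x, x + opp_at x = zero_at x;
  addNx : forall x, opp_at x + x = zero_at x;
  mulx0 : forall x, x * zero_at x = zero_at x
}.

Lemma completely_regular_zeros (S : semiringType) :
  completely_regular S -> inhabited (local_zeros S).
Proof.
move=> crS.
have /choice[z /choice[n zn]] (x : S) : exists z n,
    [/\ x + z = x, x + n = z, n + x = z & x * z = z].
  have [A [Ax [addC [z [add0 [opp addN]]]]]] := crS x.
  pose u : subsemiring_type A := exist _ x (mem_set Ax).
  exists (val z), (val (opp u)); split.
  - by rewrite -[RHS](congr1 val (add0 u)) addC.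
  - by rewrite -(addN u) addC.
  - by rewrite -(addN u).
  have idem : u * z + u * z = u * z by rewrite -smulDr add0.
  suff : u * z = z by move/(congr1 val).
  by rewrite -[LHS]add0 -{1}(addN (u * z)) -saddA idem addN.
by constructor; exists z n => x; case: (zn x).
Qed.

Section LocalZeros.
Variables (S : semiringType) (R : local_zeros S).
Implicit Types x y e : S.

Local Notation "x ^0" := (zero_at R x) (at level 2, format "x ^0").

Lemma add0x x : x^0 + x = x.
Proof. by rewrite -(addxN R) -saddA addNx addx0. Qed.

Lemma zero_idem x : x^0 + x^0 = x^0.
Proof. by rewrite -{2}(addxN R) saddA add0x addxN. Qed.

(** The zero does not depend on the ring chosen around x: it is the identity of
the maximal additive subgroup containing x. *)
Lemma zero_unique x e m : x + e = x -> x + m = e -> x^0 = e.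
Proof.
move=> xe xm.
have <- : x^0 + e = e by rewrite -xm saddA add0x.
by rewrite -(addNx R) -saddA xe.
Qed.

Lemma zero_id e : e + e = e -> e^0 = e.
Proof. by move=> ee; apply: (@zero_unique _ _ e). Qed.

Lemma zero_mulr x y : x * y^0 = (x * y)^0.
Proof.
apply/esym/(@zero_unique _ _ (x * opp_at R y)).
  by rewrite -smulDr addx0.
by rewrite -smulDr addxN.
Qed.

Lemma zero_mull x y : x^0 * y = (x * y)^0.
Proof.
apply/esym/(@zero_unique _ _ (opp_at R x * y)).
  by rewrite -smulDl addx0.
by rewrite -smulDl addxN.
Qed.

Lemma zeroM x y : x^0 * y^0 = (x * y)^0.
Proof. by rewrite zero_mulr zero_mull zero_id ?zero_idem. Qed.

(** * The congruences D, L and R on a band orthoring *)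

Variables (E : subsemiring S) (EE : (E : set S) = @Eplus S).
Hypothesis hE : band_semiring (subsemiring_type E).

Lemma Ezero x : subsemiring_set E (x^0).
Proof. by rewrite EE; apply: zero_idem. Qed.

Definition zero_part x : subsemiring_type E :=
  exist _ (x^0) (mem_set (Ezero x)).

(** With a = x^0 + y^0, moving the zero from one factor to the other gives
(x + y)^0 = (x + y) * (x + y)^0 = a * (x + y), and then
a * (x + y) = a * (x^0 + y^0) = a * a = a. *)
Lemma zeroD x y : (x + y)^0 = x^0 + y^0.
Proof.
have [in_x in_y] := (Ezero x, Ezero y).
pose a := x^0 + y^0.
have Ea : subsemiring_set E a by apply: subsemiringD.
have aa : a * a = a := congr1 val (hE.1.2 (exist _ a (mem_set Ea))).
have za : (x + y)^0 = a * (x + y).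
  by rewrite -(mulx0 R) smulDl !zero_mulr -!zero_mull -smulDl.
by rewrite za smulDr !smulDl !zero_mull -!zeroM -!smulDl -smulDr.
Qed.

Lemma zero_part_hom : semiring_hom zero_part.
Proof. by split=> x y; apply: val_inj; rewrite /= ?zeroD ?zeroM. Qed.

(** Both sides are sums of x and f = x^0 + e + x^0 in one order or the other.
Each sum has zero f, as zeros are additive, hence equals f + x + f. *)
Lemma add_zero_comm x e : e + e = e -> x + e + x^0 = x^0 + e + x.
Proof.
move=> ee; pose f := x^0 + e + x^0.
have ff : f^0 = f by rewrite /f !zeroD (zero_id ee) !(zero_id (zero_idem x)).
have xf : x + f = x + e + x^0 by rewrite /f !saddA addx0.
have fx : f + x = x^0 + e + x by rewrite /f -saddA add0x.
have zxf : (x + f)^0 = f by rewrite zeroD ff /f !saddA zero_idem.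
have zfx : (f + x)^0 = f by rewrite zeroD ff /f -saddA zero_idem.
rewrite -xf -fx -(add0x (x + f)) -(addx0 R (f + x)) zxf zfx.
by rewrite saddA.
Qed.

Lemma zero_addR c x y :
  x^0 + y^0 = y^0 -> y^0 + x^0 = x^0 -> y^0 + c^0 + x^0 + c^0 = x^0 + c^0.
Proof.
move=> xy yx.
have xyE : zero_part x + zero_part y = zero_part y by apply: val_inj.
have yxE : zero_part y + zero_part x = zero_part x by apply: val_inj.
exact: (congr1 val (band_addR hE (zero_part c) xyE yxE)).
Qed.

Definition cong_D : congruence S := congruence_preim zero_part_hom (band_D hE).
Definition cong_L : congruence S := congruence_preim zero_part_hom (band_L hE).

(** Elements with R-related zeros and the same ring component: the second
zero carries one to the other. *)
Definition relR x y : Prop := x = y + x^0 /\ y = x + y^0.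

Lemma relR_zero x y : relR x y -> x^0 + y^0 = y^0 /\ y^0 + x^0 = x^0.
Proof.
move=> [xy yx]; split.
  by rewrite [in RHS]yx zeroD (zero_id (zero_idem y)).
by rewrite [in RHS]xy zeroD (zero_id (zero_idem x)).
Qed.

(** By [add_zero_comm] the zeros can be gathered between y and z, where
regularity of E applies. *)
Lemma relR_add2r z x y : relR x y -> x + z = y + z + (x + z)^0.
Proof.
move=> xy; have [zxy zyx] := relR_zero xy.
rewrite zeroD saddA -(saddA y z) -(saddA y) add_zero_comm ?zero_idem //.
transitivity (y + (y^0 + z^0 + x^0 + z^0) + z); last first.
  by rewrite !saddA addx0 -(saddA _ z^0 z) add0x.
by rewrite zero_addR // !saddA -(saddA _ z^0 z) add0x -xy.1.
Qed.

Lemma relR_add2l z x y : relR x y -> z + x = z + y + (z + x)^0.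
Proof.
move=> xy; have [zxy zyx] := relR_zero xy.
have zyz : z^0 + y^0 + z^0 + y^0 = z^0 + y^0.
  by rewrite -saddA -(zeroD z y) zero_idem.
transitivity (z + (z^0 + y^0 + z^0 + y^0 + x^0) + x).
  by rewrite zyz -(saddA _ y^0) zyx !saddA addx0 -saddA add0x.
transitivity (z + (y^0 + z^0 + (y + x^0))).
  rewrite -xy.1 -!saddA (saddA y^0 x^0) zyx add0x (saddA z z^0) addx0.
  by rewrite !saddA.
transitivity (z + (y^0 + z^0 + y) + x^0); first by rewrite !saddA.
by rewrite -add_zero_comm ?zero_idem // zeroD -{2}zyx !saddA.
Qed.

Definition cong_R : congruence S.
Proof.
apply: (@congruence_of_translations S relR).
- by move=> x; rewrite /relR addx0.
- by move=> x y [].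
- move=> x y z xy yz.
  have [[zxy zyx] [zyz zzy]] := (relR_zero xy, relR_zero yz).
  split.
    by rewrite {1}xy.1 yz.1 -saddA zyx.
  by rewrite {1}yz.2 xy.2 -saddA zyz.
- by move=> z x y xy; split; apply: relR_add2l => //; case: xy.
- by move=> z x y xy; split; apply: relR_add2r => //; case: xy.
- by move=> z x y [xy yx]; split; rewrite -zero_mulr -smulDr -?xy -?yx.
- by move=> z x y [xy yx]; split; rewrite -zero_mull -smulDl -?xy -?yx.
Defined.

Lemma cong_RE x y : cong_R x y = (x = y + x^0 /\ y = x + y^0).
Proof. exact: erefl. Qed.

Lemma cong_LE x y : cong_L x y <-> x^0 + y^0 = x^0 /\ y^0 + x^0 = y^0.
Proof.
by split=> -[xy yx]; split; [ exact: (congr1 val xy) | exact: (congr1 val yx)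
  | exact: val_inj | exact: val_inj ].
Qed.

Lemma cong_DE x y :
  cong_D x y <-> x^0 + y^0 + x^0 = x^0 /\ y^0 + x^0 + y^0 = y^0.
Proof.
by split=> -[xy yx]; split; [ exact: (congr1 val xy) | exact: (congr1 val yx)
  | exact: val_inj | exact: val_inj ].
Qed.

Lemma cong_R_D x y : cong_R x y -> cong_D x y.
Proof.
by move=> /relR_zero[xy yx]; apply/cong_DE; rewrite xy yx.
Qed.

Lemma cong_L_D x y : cong_L x y -> cong_D x y.
Proof.
by move=> /cong_LE[xy yx]; apply/cong_DE; rewrite xy yx !zero_idem.
Qed.

Lemma cong_RL_eq x y : cong_R x y -> cong_L x y -> x = y.
Proof.
move=> xy /cong_LE[zxy _]; have [zyx _] := relR_zero xy.
by rewrite xy.1 -zxy zyx addx0.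
Qed.

(** The intermediate element x + y^0 takes its ring component from x and, in
the rectangular D-class of the zeros, its L-class from y. *)
Lemma cong_D_RL x y : cong_D x y -> exists z, cong_R x z /\ cong_L z y.
Proof.
move=> /cong_DE[xy yx]; exists (x + y^0); split.
  rewrite cong_RE zeroD (zero_id (zero_idem y)); split.
    by rewrite -{2}(addx0 R x) -!saddA (saddA x^0) xy addx0.
  by rewrite saddA addx0.
apply/cong_LE; rewrite zeroD (zero_id (zero_idem y)) -saddA zero_idem.
split=> //.
by rewrite saddA yx.
Qed.

(** * Quotients of a band orthoring *)

Section Quotient.
Variable rho : congruence S.

(** Adding -x to the congruence of x + x and x gives that of x and x^0. *)
Lemma quot_idem_lift (u : quot rho) :
  u + u = u -> exists e, e + e = e /\ u = quot_pi rho e.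
Proof.
elim/quot_ind: u => x; rewrite -(quot_pi_hom rho).1 => /quot_piP xx.
exists (x^0); split; first exact: zero_idem.
apply/quot_piP; have := congD xx (cong_refl rho (opp_at R x)).
by rewrite -saddA (addxN R) addx0.
Qed.

(** The idempotents of a quotient form the image of E, so a class of band
semirings P has to be checked only on semirings all of whose elements lift to
idempotents of S. *)
Lemma quot_orthoring (P : semiringType -> Prop) :
    completely_regular S ->
    (forall F : subsemiring (quot rho),
       band_semiring (subsemiring_type F) ->
       (forall w : subsemiring_type F, exists e,
          e + e = e /\ val w = quot_pi rho e) ->
       P (subsemiring_type F)) ->
  orthoring_over P (quot rho).
Proof.
move=> crS hP; split; first exact: quot_completely_regular.
have [piD piM] := quot_pi_hom rho.
pose F := image_subsemiring (quot_pi_hom rho) E.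
have FE : (F : set (quot rho)) = @Eplus (quot rho).
  apply/seteqP; split=> [_ [e + <-]|u].
    by rewrite EE /Eplus /= => ee; rewrite -piD ee.
  move=> /quot_idem_lift[e [ee ->]]; exists e => //.
  by rewrite EE.
exists F; split=> //; apply: hP.
  have [g [ghom gsurj]] := image_subsemiring_onto (quot_pi_hom rho) E.
  exact: image_band_semiring ghom gsurj hE.
move=> w; apply: quot_idem_lift.
by move: (set_mem (valP w)); move: (val w) => u; rewrite FE.
Qed.

End Quotient.

Lemma idem_add e f : e + e = e -> f + f = f -> e + f + (e + f) = e + f.
Proof. by move=> ee ff; have := zero_idem (e + f); rewrite zeroD !zero_id. Qed.

Lemma cong_R_left_regular e f :
  e + e = e -> f + f = f -> cong_R (e + f + e) (e + f).
Proof.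
move=> ee ff; have efef := idem_add ee ff.
rewrite cong_RE !zeroD !zero_id //; split; first by rewrite saddA efef.
by rewrite -(saddA (e + f) e) (saddA e e f) ee efef.
Qed.

Lemma cong_L_right_regular e f :
  e + e = e -> f + f = f -> cong_L (e + f + e) (f + e).
Proof.
move=> ee ff; have fefe := idem_add ff ee.
apply/cong_LE; rewrite !zeroD !zero_id //; split.
  by rewrite -(saddA e f e) -saddA fefe.
by rewrite !saddA -(saddA f e e) ee -saddA fefe.
Qed.

End LocalZeros.

Theorem theorem4p6 (S : semiringType) (hS : band_orthoring S) :
  exists S1 S2 T : semiringType,
    [/\ left_band_orthoring S1, right_band_orthoring S2, weak_clifford T
      & spined_product S S1 S2 T].
Proof.
have [crS [E [EE hE]]] := hS; have [R] := completely_regular_zeros crS.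
exists (quot (cong_R R EE hE)), (quot (cong_L R EE hE)),
  (quot (cong_D R EE hE)).
split.
- apply: (quot_orthoring R EE hE crS) => F hF lift.
  apply: left_regular_left_band => // u v; apply: val_inj => /=.
  have [[e [ee ->]] [f [ff ->]]] := (lift u, lift v).
  rewrite -!(quot_pi_hom _).1; apply/quot_piP; exact: cong_R_left_regular.
- apply: (quot_orthoring R EE hE crS) => F hF lift.
  apply: right_regular_right_band => // u v; apply: val_inj => /=.
  have [[e [ee ->]] [f [ff ->]]] := (lift u, lift v).
  rewrite -!(quot_pi_hom _).1; apply/quot_piP; exact: cong_L_right_regular.
- apply/lattice_weak_clifford/preim_lattice_laws; exact: band_D_lattice.
- apply: spined_product_quot.
  + exact: cong_R_D.
  + exact: cong_L_D.
  + exact: cong_RL_eq.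
  + exact: cong_D_RL.
Qed.
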